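(* Let $\mathcal V$ be the category of normed (resp. seminormed) vector spaces over $R=\mathbb R$ or $\mathbb C$ with nonexpansive linear maps. Then the completion $\mathcal V$-monad $\widetilde{\mathbb T}$ on $\underline{\mathcal V}$ is the idempotent $\mathcal V$-core of the double-dualization $\mathcal V$-monad $\mathbb T$ on $\underline{\mathcal V}$. Moreover, $\Sigma_T=\Sigma_{\widetilde T}$ is the class of all dense, isometric morphisms in $\mathcal V$.
   Context: $\mathcal V$ is either $\mathbf{Norm}_1$ or $\mathbf{SNorm}_1$: normed, resp. seminormed, vector spaces over $R=\mathbb R$ or $\mathbb C$, with linear maps that are nonexpansive ($\|f(v)\|\le\|v\|$). $\mathcal V$ is symmetric monoidal closed: the internal hom $\underline{\mathcal V}(V,W)$ is the space of all bounded linear maps $V\to W$ with the operator (semi)norm, and $V\otimes W$ is the algebraic tensor product with the projective (semi)norm $\|x\|=\inf\{\sum_i\|v_i\|\|w_i\| : x=\sum_{i=1}^n v_i\otimes w_i\}$. $\underline{\mathcal V}$ is $\mathcal V$ viewed as a $\mathcal V$-category. The dual is $V^*=\underline{\mathcal V}(V,R)$. The double-dualization $\mathcal V$-monad $\mathbb T=(T,\eta,\mu)$ is the one induced by the $\mathcal V$-adjunction $(-)^*\dashv(-)^*:\underline{\mathcal V}^{\mathrm{op}}\to\underline{\mathcal V}$; thus $TV=V^{**}$ and $\eta_V:V\to V^{**}$ is the canonical evaluation map. A morphism $h$ is isometric if $\|h(v)\|=\|v\|$ for all $v$ (not necessarily injective), and dense if its image is dense in its codomain. The full subcategory $\mathbf{Ban}_1$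 of Banach spaces (normed and Cauchy-complete) is a $\mathcal V$-reflective-subcategory of $\underline{\mathcal V}$, i.e. the inclusion has a left $\mathcal V$-adjoint $V\mapsto\widetilde V$, with unit $\rho_V:V\to\widetilde V$ the usual completion, a dense isometric morphism into a Banach space. $\widetilde{\mathbb T}$, with $\widetilde TV=\widetilde V$, is the induced idempotent $\mathcal V$-monad, called the completion $\mathcal V$-monad. For an endofunctor $S$, $\Sigma_S$ denotes the class of morphisms sent by $S$ to isomorphisms. An idempotent $\mathcal V$-core of a $\mathcal V$-monad $\mathbb T$ is an idempotent $\mathcal V$-monad (one with invertible multiplication) on the same $\mathcal V$-category whose underlying endofunctor inverts the same morphisms as $T$; it is unique up to isomorphism if it exists. *)

(* Defs.v *)
From HB Require Import structures.
From mathcomp Require Import all_boot all_order all_algebra.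
From mathcomp Require Import generic_quotient complex.
From mathcomp Require Import boolp classical_sets functions reals.

Set Implicit Arguments.
Unset Strict Implicit.
Unset Printing Implicit Defensive.

Import Order.TTheory GRing.Theory Num.Theory.
Local Open Scope classical_set_scope.
Local Open Scope quotient_scope.
Local Open Scope ring_scope.

Inductive scalar_kind := RealScalars | ComplexScalars.

Section Scalars.
Variables (R : realType) (k : scalar_kind).

Definition scalars : fieldType :=
  match k with RealScalars => R | ComplexScalars => R[i] end.

(* The absolute value of a scalar, with values in R; the library norm on R[i]
   takes its values in R[i]. *)
Definition modulus : scalars -> R :=
  match k as k' return
    (match k' with RealScalars => R | ComplexScalars => R[i] end : fieldType) -> R
  with
  | RealScalars => fun a : R => `|a|
  | ComplexScalars => fun a : R[i] => Normc.normc a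
  end.

Definition real_scalar : R -> scalars :=
  match k as k' return
    R -> (match k' with RealScalars => R | ComplexScalars => R[i] end : fieldType)
  with
  | RealScalars => fun a => a
  | ComplexScalars => fun a => (a%:C)%C
  end.

End Scalars.

Section ScalarTheory.
Variables (R : realType) (k : scalar_kind).
Implicit Types a b : scalars R k.

Lemma modulusD a b : modulus (a + b) <= modulus a + modulus b.
Proof. by case: k a b => a b; [exact: ler_normD|exact: le_normcD]. Qed.

Lemma modulusM a b : modulus (a * b) = modulus a * modulus b.
Proof. by case: k a b => a b; [exact: normrM|exact: Normc.normcM]. Qed.

Lemma modulus_eq0 a : modulus a = 0 -> a = 0.
Proof. by case: k a => a; [exact: normr0_eq0|exact: Normc.eq0_normc]. Qed.

Lemma modulusMn a n : modulus (a *+ n) = modulus a *+ n.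
Proof. by case: k a => a; [exact: normrMn|exact: normcMn]. Qed.

Lemma modulusN a : modulus (- a) = modulus a.
Proof. by case: k a => a; [exact: normrN|exact: normcN]. Qed.

Lemma modulus_ge0 a : 0 <= modulus a.
Proof. by case: k a => [a|[a b]]; [exact: normr_ge0|exact: sqrtr_ge0]. Qed.

Lemma modulus_real (r : R) : modulus (real_scalar k r) = `|r|.
Proof. by case: k => //=; rewrite expr0n /= addr0 sqrtr_sqr. Qed.

Lemma real_scalar1 : real_scalar k (1 : R) = 1.
Proof. by case: k. Qed.

Lemma modulus1 : modulus (1 : scalars R k) = 1.
Proof. by rewrite -real_scalar1 modulus_real normr1. Qed.
End ScalarTheory.

HB.mixin Record isSemiNormedModule (R : realType) (k : scalar_kind) V
    of Num.SemiNormedZmodule R V & GRing.Lmodule (scalars R k) V := {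
  seminormZ : forall (a : scalars R k) (x : V), `|a *: x| = modulus a * `|x|
}.

#[short(type="semiNormedModType")]
HB.structure Definition SemiNormedModule (R : realType) (k : scalar_kind) :=
  { V of Num.SemiNormedZmodule R V & GRing.Lmodule (scalars R k) V
       & isSemiNormedModule R k V }.

Definition is_normed R k (V : semiNormedModType R k) : Prop :=
  forall x : V, `|x| = 0 -> x = 0.

Definition scalar_space R k := (scalars R k)^o.
Section ScalarSpace.
Variables (R : realType) (k : scalar_kind).
HB.instance Definition _ := GRing.Lmodule.on (scalar_space R k).
HB.instance Definition _ :=
  Num.Zmodule_isSemiNormed.Build R (scalar_space R k)
    (@modulusD R k) (@modulusMn R k) (@modulusN R k).
HB.instance Definition _ :=
  isSemiNormedModule.Build R k (scalar_space R k) (@modulusM R k).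
End ScalarSpace.

(* Loaded only now: declaring SemiNormedModule in the presence of NormedModule
   fails, since Hierarchy Builder then asks for a join of the two. *)
From mathcomp Require Import topology normedtype sequences.
Import numFieldNormedType.Exports.
Section BoundedMaps.
Variables (R : realType) (k : scalar_kind) (V W : semiNormedModType R k).

Definition bounded_linear : {pred V -> W} := fun f =>
  `[< linear f /\ exists C : R, forall x, `|f x| <= C * `|x| >].

Lemma bounded_linear_closed : submod_closed bounded_linear.
Proof.
split.
  apply/asboolP; split; first by move=> a u v /=; rewrite scaler0 addr0.
  by exists 0 => x; rewrite normr0 mul0r.
move=> a f g /asboolP[lf [C Cf]] /asboolP[lg [D Dg]].
have E x : (a *: f + g) x = a *: f x + g x by [].
apply/asboolP; split.
  by move=> b u v; rewrite !E lf lg !scalerDr !scalerA (mulrC a b) addrACA.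
exists (modulus a * C + D) => x.
rewrite E (le_trans (ler_normD _ _))// seminormZ mulrDl lerD// -mulrA.
by rewrite ler_wpM2l// modulus_ge0.
Qed.

HB.instance Definition _ :=
  GRing.isSubmodClosed.Build (scalars R k) (V -> W) bounded_linear
    bounded_linear_closed.

Record bmap := BMap {
  bmap_fun :> V -> W;
  bmapP : bmap_fun \in bounded_linear }.

HB.instance Definition _ := [isSub for bmap_fun].
HB.instance Definition _ := [Choice of bmap by <:].
HB.instance Definition _ := [SubChoice_isSubLmodule of bmap by <:].

End BoundedMaps.

Lemma modulus0 R k : modulus (0 : scalars R k) = 0.
Proof. by case: k; [exact: normr0|exact: Normc.normc0]. Qed.

Section BoundedMapTheory.
Variables (R : realType) (k : scalar_kind) (V W : semiNormedModType R k).
Implicit Types f g : bmap V W.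

Lemma bmap_eq f g : f =1 g -> f = g.
Proof. by move=> fg; apply: val_inj; apply: funext. Qed.

Lemma bmap_linear f : linear f.
Proof. by have /asboolP[] := bmapP f. Qed.

HB.instance Definition _ f :=
  GRing.isLinear.Build (scalars R k) V W *:%R (bmap_fun f) (bmap_linear f).

Lemma bmap_bounded f : exists2 C : R, 0 <= C & forall x, `|f x| <= C * `|x|.
Proof.
have /asboolP[_ [C Cf]] := bmapP f.
exists `|C| => // x; apply: le_trans (Cf x) _.
by rewrite ler_wpM2r// ler_norm.
Qed.

Definition opnorm f : R := sup [set `|f x| | x in [set x | `|x| <= 1]].

Lemma opnorm_has_sup f : has_sup [set `|f x| | x in [set x | `|x| <= 1]].
Proof.
split; first by exists `|f 0|; exists 0 => //=; rewrite normr0.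
have [C C0 Cf] := bmap_bounded f.
exists C => _ [x /= x1 <-]; apply: le_trans (Cf x) _.
by rewrite -[leRHS]mulr1 ler_wpM2l.
Qed.

Lemma opnorm_ge0 f : 0 <= opnorm f.
Proof.
rewrite -(normr0 W) -(linear0 f); apply: ub_le_sup.
  by case: (opnorm_has_sup f).
by exists 0 => //=; rewrite normr0.
Qed.

Lemma bmap_le f x : `|f x| <= opnorm f * `|x|.
Proof.
have [x0|x0] := eqVneq `|x| 0.
  have [C _ Cf] := bmap_bounded f.
  by apply: le_trans (Cf x) _; rewrite x0 !mulr0.
rewrite -ler_pdivrMr ?lt_def ?x0 ?normr_ge0//.
have m : modulus (real_scalar k `|x|^-1) = `|x|^-1.
  by rewrite modulus_real normfV normr_id.
rewrite mulrC -m -seminormZ -linearZ; apply: ub_le_sup.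
  by case: (opnorm_has_sup f).
by exists (real_scalar k `|x|^-1 *: x) => //=; rewrite seminormZ m mulVf.
Qed.

Lemma opnorm_le f C : 0 <= C -> (forall x, `|f x| <= C * `|x|) -> opnorm f <= C.
Proof.
move=> C0 Cf; apply: ge_sup; first by case: (opnorm_has_sup f).
move=> _ [x /= x1 <-]; apply: le_trans (Cf x) _.
by rewrite -[leRHS]mulr1 ler_wpM2l.
Qed.

Lemma opnormD f g : opnorm (f + g) <= opnorm f + opnorm g.
Proof.
apply: opnorm_le => [|x]; first by rewrite addr_ge0 ?opnorm_ge0.
by rewrite mulrDl (le_trans (ler_normD _ _))// lerD ?bmap_le.
Qed.

Lemma opnormZ (a : scalars R k) f : opnorm (a *: f) = modulus a * opnorm f.
Proof.
have le b h : opnorm (b *: h) <= modulus b * opnorm h.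
  apply: opnorm_le => [|x]; first by rewrite mulr_ge0 ?opnorm_ge0 ?modulus_ge0.
  by rewrite [X in `|X|]/(b *: h x) seminormZ -mulrA ler_wpM2l ?modulus_ge0 ?bmap_le.
apply/eqP; rewrite eq_le le /=.
have [->|a0] := eqVneq a 0.
  by rewrite modulus0 mul0r opnorm_ge0.
have ma : 0 < modulus a.
  by rewrite lt_def modulus_ge0 andbT; apply: contra_neq a0 => /modulus_eq0.
have ma' : modulus a^-1 = (modulus a)^-1.
  by apply: (mulfI (lt0r_neq0 ma)); rewrite -modulusM !mulfV ?modulus1 ?lt0r_neq0.
by rewrite -ler_pdivlMl// -ma' (le_trans _ (le _ _))// scalerK.
Qed.

Lemma opnormN f : opnorm (- f) = opnorm f.
Proof. by rewrite -scaleN1r opnormZ modulusN modulus1 mul1r. Qed.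

Lemma opnormMn f n : opnorm (f *+ n) = opnorm f *+ n.
Proof.
by rewrite -scaler_nat opnormZ modulusMn modulus1 mulr_natl.
Qed.

HB.instance Definition _ :=
  Num.Zmodule_isSemiNormed.Build R (bmap V W) opnormD opnormMn opnormN.
HB.instance Definition _ :=
  isSemiNormedModule.Build R k (bmap V W) opnormZ.

Lemma bmap_norm_le f x : `|f x| <= `|f| * `|x|.
Proof. exact: bmap_le. Qed.

Lemma bmap_normed : is_normed W -> is_normed (bmap V W).
Proof.
move=> sW f f0; apply: bmap_eq => x; apply: sW; apply/eqP.
by rewrite eq_le normr_ge0 andbT (le_trans (bmap_norm_le f x))// f0 mul0r.
Qed.

Lemma bmap_norm_leP f C :
  0 <= C -> `|f| <= C <-> forall x, `|f x| <= C * `|x|.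
Proof.
move=> C0; split=> [fC x|]; last exact: opnorm_le.
by rewrite (le_trans (bmap_norm_le f x))// ler_wpM2r.
Qed.

Lemma bmap_norm_le1P f : `|f| <= 1 <-> forall x, `|f x| <= `|x|.
Proof.
by split=> [/bmap_norm_leP fC x|fC]; [rewrite -[leRHS]mul1r fC|
  apply/bmap_norm_leP => // x; rewrite mul1r].
Qed.

End BoundedMapTheory.

Definition mk_bmap R k (V W : semiNormedModType R k) (f : V -> W) (C : R)
    (lf : linear f) (Cf : forall x, `|f x| <= C * `|x|) : bmap V W :=
  BMap (asboolT (conj lf (ex_intro _ C Cf)) : f \in @bounded_linear R k V W).

Section BoundedMapOps.
Variables (R : realType) (k : scalar_kind).
Implicit Types U V W X : semiNormedModType R k.

Fact bid_linear V : linear (@id V). Proof. by []. Qed.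
Fact bid_le V (x : V) : `|x| <= 1 * `|x|. Proof. by rewrite mul1r. Qed.
Definition bid V : bmap V V := mk_bmap (@bid_linear V) (@bid_le V).

Section Comp.
Variables (U V W : semiNormedModType R k) (g : bmap V W) (f : bmap U V).
Fact bcomp_linear : linear (g \o f).
Proof. by move=> a x y /=; rewrite !linearP. Qed.
Fact bcomp_le x : `|(g \o f) x| <= `|g| * `|f| * `|x|.
Proof.
by rewrite (le_trans (bmap_norm_le _ _))// -mulrA ler_wpM2l// bmap_norm_le.
Qed.
Definition bcomp : bmap U W := mk_bmap bcomp_linear bcomp_le.
Lemma bcomp_norm : `|bcomp| <= `|g| * `|f|.
Proof. by apply/bmap_norm_leP; [rewrite mulr_ge0|exact: bcomp_le]. Qed.
End Comp.

Section Precomp.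
Variables (V W X : semiNormedModType R k) (f : bmap V W).
Fact precomp_linear : linear (fun g : bmap W X => bcomp g f).
Proof. by move=> a g h; apply: bmap_eq. Qed.
Fact precomp_le (g : bmap W X) : `|bcomp g f| <= `|f| * `|g|.
Proof. by rewrite mulrC bcomp_norm. Qed.
Definition precomp : bmap (bmap W X) (bmap V X) :=
  mk_bmap precomp_linear precomp_le.
Lemma precomp_norm : `|precomp| <= `|f|.
Proof. exact/bmap_norm_leP/precomp_le. Qed.
End Precomp.

Section Eval.
Variables (V X : semiNormedModType R k).
Fact eval_at_linear (x : V) : linear (fun f : bmap V X => f x).
Proof. by []. Qed.
Fact eval_at_le (x : V) (f : bmap V X) : `|f x| <= `|x| * `|f|.
Proof. by rewrite mulrC bmap_norm_le. Qed.
Definition eval_at (x : V) : bmap (bmap V X) X :=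
  mk_bmap (@eval_at_linear x) (@eval_at_le x).
Fact eval_linear : linear eval_at.
Proof. by move=> a x y; apply: bmap_eq => f /=; rewrite linearP. Qed.
Fact eval_le x : `|eval_at x| <= 1 * `|x|.
Proof. by rewrite mul1r; apply/bmap_norm_leP => // f; apply: eval_at_le. Qed.
Definition eval : bmap V (bmap (bmap V X) X) := mk_bmap eval_linear eval_le.
Lemma eval_norm : `|eval| <= 1.
Proof. exact/bmap_norm_leP/eval_le. Qed.
End Eval.

End BoundedMapOps.

Inductive norm_kind := Normed | SemiNormed.

(* The objects of Norm_1 (s = Normed) and of SNorm_1 (s = SemiNormed). *)
Record nspace (R : realType) (k : scalar_kind) (s : norm_kind) := NSpace {
  nspace_mod :> semiNormedModType R k;
  nspace_normed : s = Normed -> is_normed nspace_mod }.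

Section EnrichedCategories.
Variables (R : realType) (k : scalar_kind) (s : norm_kind).
Local Notation nspace := (nspace R k s).

(* Categories enriched in Norm_1 or SNorm_1. By the universal property of the
   projective tensor product, a nonexpansive linear map
   hom B C (x) hom A B -> hom A C is a bilinear map vcomp that satisfies
   vcomp_le; a nonexpansive linear map from the scalars to hom A A is an element
   vid A of norm at most 1. *)
Record vcat := VCat {
  vob :> Type;
  vhom : vob -> vob -> nspace;
  vid : forall A, vhom A A;
  vcomp : forall A B C, vhom B C -> vhom A B -> vhom A C;
  vid_le1 : forall A, `|vid A| <= 1;
  vcomp_linl : forall A B C (f : vhom A B),
    linear (fun g : vhom B C => vcomp g f);
  vcomp_linr : forall A B C (g : vhom B C),
    linear (fun f : vhom A B => vcomp g f);
  vcomp_le : forall A B C (g : vhom B C) (f : vhom A B),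
    `|vcomp g f| <= `|g| * `|f|;
  vcompA : forall A B C D (h : vhom C D) (g : vhom B C) (f : vhom A B),
    vcomp h (vcomp g f) = vcomp (vcomp h g) f;
  vcomp1l : forall A B (f : vhom A B), vcomp (vid B) f = f;
  vcomp1r : forall A B (f : vhom A B), vcomp f (vid A) = f }.

Arguments vid {v} A.
Arguments vcomp {v A B C} g f.
Local Notation "g \@ f" := (vcomp g f) (at level 50, left associativity).

(* Morphisms A -> B of the underlying ordinary category: nonexpansive maps from
   the scalars to hom A B, i.e. elements of norm at most 1. *)
Record vmor (C : vcat) (A B : C) := VMor {
  vmor_hom :> vhom A B;
  vmor_le1 : `|vmor_hom| <= 1 }.

Definition is_viso (C : vcat) (A B : C) (f : vmor A B) : Prop :=
  exists g : vmor B A, g \@ f = vid A /\ f \@ g = vid B.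

Section Opposite.
Variable C : vcat.
Definition opcat : vcat.
refine (@VCat C (fun A B => @vhom C B A) (fun A => @vid C A)
  (fun A B D g f => f \@ g) _ _ _ _ _ _ _).
- exact: vid_le1.
- by move=> A B D f; apply: vcomp_linr.
- by move=> A B D g; apply: vcomp_linl.
- by move=> A B D g f; rewrite mulrC; apply: vcomp_le.
- by move=> A B D E h g f; rewrite vcompA.
- by move=> A B f; apply: vcomp1r.
- by move=> A B f; apply: vcomp1l.
Defined.
End Opposite.

Section FullSubcategory.
Variables (C : vcat) (P : C -> Prop).
Definition fullsub : vcat.
refine (@VCat {A : C | P A} (fun A B => vhom (sval A) (sval B))
  (fun A => vid (sval A)) (fun A B D g f => g \@ f) _ _ _ _ _ _ _).
- by move=> A; apply: vid_le1.
- by move=> A B D f; apply: vcomp_linl.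
- by move=> A B D g; apply: vcomp_linr.
- by move=> A B D g f; apply: vcomp_le.
- by move=> A B D E h g f; apply: vcompA.
- by move=> A B f; apply: vcomp1l.
- by move=> A B f; apply: vcomp1r.
Defined.
End FullSubcategory.

Record vfunctor (C D : vcat) := VFunctor {
  fob :> C -> D;
  fhom : forall A B : C, vhom A B -> vhom (fob A) (fob B);
  fhom_lin : forall A B : C, linear (@fhom A B);
  fhom_le : forall (A B : C) (f : vhom A B), `|fhom f| <= `|f|;
  fhom_id : forall A : C, fhom (vid A) = vid (fob A);
  fhom_comp : forall (A B E : C) (g : vhom B E) (f : vhom A B),
    fhom (g \@ f) = fhom g \@ fhom f }.

Definition fmor (C D : vcat) (F : vfunctor C D) (A B : C) (f : vmor A B) :
  vmor (F A) (F B) :=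
  VMor (le_trans (fhom_le F f) (vmor_le1 f)).

Definition fid (C : vcat) : vfunctor C C.
by refine (@VFunctor C C id (fun A B f => f) _ _ _ _).
Defined.

Definition fcomp (C D E : vcat) (G : vfunctor D E) (F : vfunctor C D) :
  vfunctor C E.
refine (@VFunctor C E (fun A => G (F A)) (fun A B f => fhom G (fhom F f))
  _ _ _ _).
- by move=> A B a f g; rewrite fhom_lin fhom_lin.
- by move=> A B f; apply: le_trans (fhom_le _ _) (fhom_le _ _).
- by move=> A; rewrite !fhom_id.
- by move=> A B X g f; rewrite !fhom_comp.
Defined.

Definition fincl (C : vcat) (P : C -> Prop) : vfunctor (fullsub P) C.
by refine (@VFunctor (fullsub P) C sval (fun A B f => f) _ _ _ _).
Defined.

(* Enriched naturality is an equality of two maps hom A B -> hom (F A) (G B), so f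
   ranges over all of hom A B, not only over the elements of norm at most 1. *)
Record vnat (C D : vcat) (F G : vfunctor C D) := VNat {
  vcomponent :> forall A : C, vmor (F A) (G A);
  naturality : forall (A B : C) (f : vhom A B),
    vcomponent B \@ fhom F f = fhom G f \@ vcomponent A }.

Record vmonad (C : vcat) := VMonad {
  vfun :> vfunctor C C;
  vunit : vnat (fid C) vfun;
  vmult : vnat (fcomp vfun vfun) vfun;
  vmult_unitl : forall A : C, vmult A \@ vunit (vfun A) = vid (vfun A);
  vmult_unitr : forall A : C, vmult A \@ fhom vfun (vunit A) = vid (vfun A);
  vmultA : forall A : C,
    vmult A \@ vmult (vfun A) = vmult A \@ fhom vfun (vmult A) }.

Record vadjunction (C D : vcat) (F : vfunctor C D) (G : vfunctor D C) :=
  VAdjunction {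
  adj_unit : vnat (fid C) (fcomp G F);
  adj_counit : vnat (fcomp F G) (fid D);
  adj_trianglel : forall A : C,
    adj_counit (F A) \@ fhom F (adj_unit A) = vid (F A);
  adj_triangler : forall B : D,
    fhom G (adj_counit B) \@ adj_unit (G B) = vid (G B) }.

Section InducedMonad.
Variables (C D : vcat) (F : vfunctor C D) (G : vfunctor D C).
Variable adj : vadjunction F G.

Definition adj_mult : vnat (fcomp (fcomp G F) (fcomp G F)) (fcomp G F).
refine (@VNat _ _ (fcomp (fcomp G F) (fcomp G F)) (fcomp G F)
  (fun A => fmor G (adj_counit adj (F A))) _).
move=> A B f /=.
by rewrite -!fhom_comp (naturality (adj_counit adj) (fhom F f)).
Defined.

Definition induced_monad : vmonad C.
refine (@VMonad C (fcomp G F) (adj_unit adj) adj_mult _ _ _).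
- by move=> A; exact: (adj_triangler adj (F A)).
- by move=> A /=; rewrite -fhom_comp adj_trianglel fhom_id.
- move=> A /=; rewrite -!fhom_comp.
  by rewrite -(naturality (adj_counit adj) (adj_counit adj (F A))).
Defined.
End InducedMonad.

(* The class Sigma_F of the morphisms that F sends to isomorphisms. *)
Definition inverted (C : vcat) (F : vfunctor C C) (A B : C) (f : vmor A B) : Prop :=
  is_viso (fmor F f).

Definition idempotent (C : vcat) (T : vmonad C) : Prop :=
  forall A : C, is_viso (vmult T A).

Definition is_idempotent_core (C : vcat) (S T : vmonad C) : Prop :=
  idempotent S /\
  forall (A B : C) (f : vmor A B), inverted S f <-> inverted T f.

End EnrichedCategories.

Arguments vid {R k s v} A.
Arguments vcomp {R k s v A B C} g f.

Section SelfEnrichment.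
Variables (R : realType) (k : scalar_kind) (s : norm_kind).
Implicit Types V W X : nspace R k s.

Definition ihom V W : nspace R k s :=
  NSpace (fun e => @bmap_normed R k V W (nspace_normed e)).

Fact scalar_normed : is_normed (scalar_space R k).
Proof. exact: modulus_eq0. Qed.
Definition vscalars : nspace R k s := NSpace (fun=> scalar_normed).

(* The category Norm_1 or SNorm_1 enriched in itself. Its morphisms, the bounded
   maps of norm at most 1, are the nonexpansive ones by bmap_norm_le1P. *)
Definition selfcat : vcat R k s.
refine (@VCat R k s (nspace R k s) ihom (fun V => bid V)
  (fun U V W g f => bcomp g f) _ _ _ _ _ _ _).
- by move=> V; apply/bmap_norm_le1P.
- by move=> U V W f a g h; apply: bmap_eq.
- by move=> U V W g a f h; apply: bmap_eq => x /=; rewrite linearP.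
- by move=> U V W g f; apply: bcomp_norm.
- by move=> U V W X h g f; apply: bmap_eq.
- by move=> V W f; apply: bmap_eq.
- by move=> V W f; apply: bmap_eq.
Defined.

Definition dual V : nspace R k s := ihom V vscalars.

Definition dual_left : vfunctor selfcat (opcat selfcat).
refine (@VFunctor R k s selfcat (opcat selfcat) dual
  (fun V W f => precomp vscalars f) _ _ _ _).
- move=> V W a f g; apply: bmap_eq => h; apply: bmap_eq => x.
  by rewrite /= linearP.
- by move=> V W f; apply: precomp_norm.
- by move=> V; apply: bmap_eq => h; apply: bmap_eq.
- by move=> V W X g f; apply: bmap_eq => h; apply: bmap_eq.
Defined.

Definition dual_right : vfunctor (opcat selfcat) selfcat.
refine (@VFunctor R k s (opcat selfcat) selfcat dual
  (fun V W f => precomp vscalars f) _ _ _ _).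
- move=> V W a f g; apply: bmap_eq => h; apply: bmap_eq => x.
  by rewrite /= linearP.
- by move=> V W f; apply: precomp_norm.
- by move=> V; apply: bmap_eq => h; apply: bmap_eq.
- by move=> V W X g f; apply: bmap_eq => h; apply: bmap_eq.
Defined.

Definition dual_unit : vnat (fid selfcat) (fcomp dual_right dual_left).
refine (@VNat R k s selfcat selfcat (fid selfcat) (fcomp dual_right dual_left)
  (fun V => @VMor R k s selfcat V (dual (dual V)) (eval V vscalars)
     (eval_norm V vscalars)) _).
by move=> V W f; apply: bmap_eq => x; apply: bmap_eq.
Defined.

(* A counit at V, from V^** to V in the opposite category, is a map V -> V^**. *)
Definition dual_counit : vnat (fcomp dual_left dual_right) (fid (opcat selfcat)).
refine (@VNat R k s (opcat selfcat) (opcat selfcat)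
  (fcomp dual_left dual_right) (fid (opcat selfcat))
  (fun V => @VMor R k s (opcat selfcat) (dual (dual V)) V (eval V vscalars)
     (eval_norm V vscalars)) _).
by move=> V W f; apply: bmap_eq => x; apply: bmap_eq.
Defined.

Definition dual_adjunction : vadjunction dual_left dual_right.
refine (@VAdjunction R k s _ _ _ _ dual_unit dual_counit _ _).
- by move=> V; apply: bmap_eq => x; apply: bmap_eq.
- by move=> V; apply: bmap_eq => x; apply: bmap_eq.
Defined.

Definition double_dual_monad : vmonad selfcat := induced_monad dual_adjunction.

End SelfEnrichment.

Definition cauchy_sequence R k (V : semiNormedModType R k) (u : nat -> V) :=
  forall e : R, 0 < e -> exists N, forall m n, (N <= m)%N -> (N <= n)%N ->
    `|u m - u n| < e.

Definition converges_to R k (V : semiNormedModType R k) (u : nat -> V) (l : V) :=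
  forall e : R, 0 < e -> exists N, forall n, (N <= n)%N -> `|u n - l| < e.

Definition cauchy_complete R k (V : semiNormedModType R k) :=
  forall u : nat -> V, cauchy_sequence u -> exists l, converges_to u l.

Definition is_banach R k (V : semiNormedModType R k) :=
  is_normed V /\ cauchy_complete V.

Section CauchySequences.
Variables (R : realType) (k : scalar_kind) (V : semiNormedModType R k).

Definition cauchy_pred : {pred nat -> V} := fun u => `[< cauchy_sequence u >].

Lemma cauchy_pred_closed : submod_closed cauchy_pred.
Proof.
split.
  by apply/asboolP => e e0; exists 0%N => m n _ _ /=; rewrite subrr normr0.
move=> a u v /asboolP cu /asboolP cv; apply/asboolP => e e0.
have C0 : 0 < 2 * (modulus a + 1) by rewrite mulr_gt0// ltr_wpDl ?modulus_ge0.
have e1 : 0 < e / (2 * (modulus a + 1)) by rewrite divr_gt0.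
have e2 : 0 < e / 2 by rewrite divr_gt0.
have [N1 cu1] := cu _ e1; have [N2 cv2] := cv _ e2.
exists (maxn N1 N2) => m n; rewrite !geq_max => /andP[m1 m2] /andP[n1 n2].
have -> : (a *: u + v) m - (a *: u + v) n = a *: (u m - u n) + (v m - v n).
  by rewrite [LHS]/((a *: u m + v m) - (a *: u n + v n)) scalerBr opprD addrACA.
rewrite (le_lt_trans (ler_normD _ _))// [ltRHS]splitr ler_ltD ?cv2//.
rewrite seminormZ.
have := ler_wpM2l (modulus_ge0 a) (ltW (cu1 _ _ m1 n1)).
move=> /le_trans-> //; rewrite mulrA ler_pdivrMr// mulrA divfK ?pnatr_eq0//.
by rewrite mulrC ler_wpM2l ?(ltW e0)// lerDl.
Qed.

HB.instance Definition _ :=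
  GRing.isSubmodClosed.Build (scalars R k) (nat -> V) cauchy_pred
    cauchy_pred_closed.

Record cauchy_seq := CauchySeq {
  cauchy_fun :> nat -> V;
  cauchy_funP : cauchy_fun \in cauchy_pred }.

HB.instance Definition _ := [isSub for cauchy_fun].
HB.instance Definition _ := [Choice of cauchy_seq by <:].
HB.instance Definition _ := [SubChoice_isSubLmodule of cauchy_seq by <:].

Implicit Types u v : cauchy_seq.

Lemma cauchy_seqP u : cauchy_sequence u.
Proof. by have /asboolP := cauchy_funP u. Qed.

Definition cauchy_norm u : R := lim ((fun n => `|u n|) @ \oo).

Lemma ler_dist_seminorm (W : semiNormedModType R k) (x y : W) :
  `| `|x| - `|y| | <= `|x - y|.
Proof.
have le (a b : W) : `|a| - `|b| <= `|a - b|.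
  by rewrite lerBlDr (le_trans _ (ler_normD _ _))// subrK.
by rewrite ler_norml lerNl opprB le andbT distrC le.
Qed.

Lemma cauchy_norm_cvg u : (fun n => `|u n|) @ \oo --> cauchy_norm u.
Proof.
apply/cauchy_cvgP/cauchy_ballP => e e0.
have [N cu] := cauchy_seqP u e0.
exists ([set x | exists2 n, (N <= n)%N & `|u n| = x],
        [set x | exists2 n, (N <= n)%N & `|u n| = x]) => /=.
  by split; exists N => // n /= Nn; exists n.
move=> [x y] /= [[m Nm <-] [n Nn <-]].
by rewrite /ball /= (le_lt_trans (ler_dist_seminorm _ _))// cu.
Qed.

Lemma cauchy_norm_cvgP u e : 0 < e -> exists N, forall n, (N <= n)%N ->
  `| `|u n| - cauchy_norm u | < e.
Proof.
move=> e0; have /cvgrPdist_lt/(_ _ e0)[N _ h] := @cauchy_norm_cvg u.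
by exists N => n /h; rewrite distrC.
Qed.

Lemma cauchy_norm_eq u l : (fun n => `|u n|) @ \oo --> l -> cauchy_norm u = l.
Proof. exact: (cvg_lim (@Rhausdorff R)). Qed.

Lemma cauchy_norm_le u (C : R) (N : nat) :
  (forall n, (N <= n)%N -> `|u n| <= C) -> cauchy_norm u <= C.
Proof.
move=> uC; apply: (ler_cvg_to (@cauchy_norm_cvg u) (cvg_cst C)).
by exists N.
Qed.

Lemma cauchy_normD u v : cauchy_norm (u + v) <= cauchy_norm u + cauchy_norm v.
Proof.
apply: (ler_cvg_to (@cauchy_norm_cvg (u + v))
  (cvgD (@cauchy_norm_cvg u) (@cauchy_norm_cvg v))).
by apply: nearW => n; apply: ler_normD.
Qed.

Lemma cauchy_normZ (a : scalars R k) u :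
  cauchy_norm (a *: u) = modulus a * cauchy_norm u.
Proof.
apply: cauchy_norm_eq.
under eq_fun do rewrite [X in `|X|]/(a *: u _) seminormZ.
by apply: cvgMl_tmp; apply: cauchy_norm_cvg.
Qed.

Lemma cauchy_normN u : cauchy_norm (- u) = cauchy_norm u.
Proof. by rewrite -scaleN1r cauchy_normZ modulusN modulus1 mul1r. Qed.

Lemma cauchy_normMn u n : cauchy_norm (u *+ n) = cauchy_norm u *+ n.
Proof. by rewrite -scaler_nat cauchy_normZ modulusMn modulus1 mulr_natl. Qed.

HB.instance Definition _ :=
  Num.Zmodule_isSemiNormed.Build R cauchy_seq
    cauchy_normD cauchy_normMn cauchy_normN.
HB.instance Definition _ :=
  isSemiNormedModule.Build R k cauchy_seq cauchy_normZ.

End CauchySequences.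

Section SeparatedQuotient.
Variables (R : realType) (k : scalar_kind) (W : semiNormedModType R k).

(* The quotient of W by the subspace of vectors of norm 0. *)
Definition sep_rel : rel W := fun x y => `|x - y| == 0.

Lemma sep_equiv_class : equiv_class_of sep_rel.
Proof.
split=> [x|x y|y x z]; first by rewrite /sep_rel subrr normr0.
  by rewrite /sep_rel distrC.
move=> /eqP xy /eqP yz; rewrite /sep_rel eq_le normr_ge0 andbT.
by rewrite -(subrKA y) (le_trans (ler_normD _ _))// xy yz addr0.
Qed.

Canonical sep_equiv := EquivRelPack sep_equiv_class.

Definition sep_quot := {eq_quot sep_equiv}.
HB.instance Definition _ := EqQuotient.on sep_quot.
HB.instance Definition _ := Choice.on sep_quot.

Implicit Types (p q : sep_quot) (x y : W).

Definition sep_pi x : sep_quot := \pi_sep_quot x.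

Lemma sep_pi_eq x y : `|x - y| = 0 -> sep_pi x = sep_pi y.
Proof. by move=> xy; apply/eqmodP; rewrite /= /sep_rel xy. Qed.

Lemma sep_pi_repr p : sep_pi (repr p) = p.
Proof. exact: reprK. Qed.

Lemma sep_repr_pi x : `|repr (sep_pi x) - x| = 0.
Proof. by apply/eqP; have /eqmodP := sep_pi_repr (sep_pi x). Qed.

Lemma sep_quotW (P : sep_quot -> Prop) : (forall x, P (sep_pi x)) -> forall p, P p.
Proof. by move=> Px p; rewrite -(sep_pi_repr p). Qed.

Definition sep_add p q := sep_pi (repr p + repr q).
Definition sep_opp p := sep_pi (- repr p).
Definition sep_scale (a : scalars R k) p := sep_pi (a *: repr p).
Definition sep_norm p : R := `|repr p|.

Lemma sep_addE x y : sep_add (sep_pi x) (sep_pi y) = sep_pi (x + y).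
Proof.
apply: sep_pi_eq; apply/eqP; rewrite eq_le normr_ge0 andbT.
rewrite opprD addrACA (le_trans (ler_normD _ _))//.
by rewrite !sep_repr_pi addr0.
Qed.

Lemma sep_oppE x : sep_opp (sep_pi x) = sep_pi (- x).
Proof. by apply: sep_pi_eq; rewrite -opprD normrN sep_repr_pi. Qed.

Lemma sep_scaleE a x : sep_scale a (sep_pi x) = sep_pi (a *: x).
Proof. by apply: sep_pi_eq; rewrite -scalerBr seminormZ sep_repr_pi mulr0. Qed.

Lemma sep_normE x : sep_norm (sep_pi x) = `|x|.
Proof.
have le (a b : W) : `|a - b| = 0 -> `|a| <= `|b|.
  by move=> ab; rewrite -{1}(subrK b a) (le_trans (ler_normD _ _))// ab add0r.
by apply/eqP; rewrite eq_le !le// ?sep_repr_pi// distrC sep_repr_pi.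
Qed.

Fact sep_addA : associative sep_add.
Proof.
elim/sep_quotW=> x; elim/sep_quotW=> y; elim/sep_quotW=> z.
by rewrite !sep_addE addrA.
Qed.
Fact sep_addC : commutative sep_add.
Proof. by elim/sep_quotW=> x; elim/sep_quotW=> y; rewrite !sep_addE addrC. Qed.
Fact sep_add0 : left_id (sep_pi 0) sep_add.
Proof. by elim/sep_quotW=> x; rewrite sep_addE add0r. Qed.
Fact sep_addN : left_inverse (sep_pi 0) sep_opp sep_add.
Proof. by elim/sep_quotW=> x; rewrite sep_oppE sep_addE addNr. Qed.

HB.instance Definition _ :=
  GRing.isZmodule.Build sep_quot sep_addA sep_addC sep_add0 sep_addN.

Lemma sep_piD x y : sep_pi (x + y) = sep_pi x + sep_pi y.
Proof. by rewrite [RHS]sep_addE. Qed.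

Fact sep_scaleA a b p : sep_scale a (sep_scale b p) = sep_scale (a * b) p.
Proof. by elim/sep_quotW: p => x; rewrite !sep_scaleE scalerA. Qed.
Fact sep_scale1 : left_id 1 sep_scale.
Proof. by elim/sep_quotW=> x; rewrite sep_scaleE scale1r. Qed.
Fact sep_scaleDr : right_distributive sep_scale +%R.
Proof.
move=> a; elim/sep_quotW=> x; elim/sep_quotW=> y.
by rewrite -sep_piD !sep_scaleE scalerDr sep_piD.
Qed.
Fact sep_scaleDl p : {morph sep_scale^~ p : a b / a + b}.
Proof. by move=> a b; elim/sep_quotW: p => x; rewrite !sep_scaleE scalerDl sep_piD. Qed.

HB.instance Definition _ :=
  GRing.Zmodule_isLmodule.Build (scalars R k) sep_quot
    sep_scaleA sep_scale1 sep_scaleDr sep_scaleDl.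

Lemma sep_piZ a x : sep_pi (a *: x) = a *: sep_pi x.
Proof. by rewrite [RHS]sep_scaleE. Qed.

Lemma sep_normD p q : sep_norm (p + q) <= sep_norm p + sep_norm q.
Proof.
elim/sep_quotW: p => x; elim/sep_quotW: q => y.
by rewrite -sep_piD !sep_normE ler_normD.
Qed.
Lemma sep_normZ a p : sep_norm (a *: p) = modulus a * sep_norm p.
Proof. by elim/sep_quotW: p => x; rewrite -sep_piZ !sep_normE seminormZ. Qed.
Lemma sep_normN p : sep_norm (- p) = sep_norm p.
Proof. by rewrite -scaleN1r sep_normZ modulusN modulus1 mul1r. Qed.
Lemma sep_normMn p n : sep_norm (p *+ n) = sep_norm p *+ n.
Proof. by rewrite -scaler_nat sep_normZ modulusMn modulus1 mulr_natl. Qed.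

HB.instance Definition _ :=
  Num.Zmodule_isSemiNormed.Build R sep_quot sep_normD sep_normMn sep_normN.
HB.instance Definition _ :=
  isSemiNormedModule.Build R k sep_quot sep_normZ.

Lemma sep_pi_norm x : `|sep_pi x| = `|x|.
Proof. exact: sep_normE. Qed.

Lemma sep_pi_linear : linear sep_pi.
Proof. by move=> a x y; rewrite sep_piD sep_piZ. Qed.

HB.instance Definition _ :=
  GRing.isLinear.Build (scalars R k) W sep_quot *:%R sep_pi sep_pi_linear.

Lemma sep_quot_normed : is_normed sep_quot.
Proof.
elim/sep_quotW=> x; rewrite sep_pi_norm => x0.
by rewrite -(linear0 sep_pi); apply: sep_pi_eq; rewrite subr0.
Qed.

Definition sep_lift_fun (X : semiNormedModType R k) (f : bmap W X) p := f (repr p).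

Lemma sep_lift_funE X (f : bmap W X) x :
  is_normed X -> sep_lift_fun f (sep_pi x) = f x.
Proof.
move=> sX; apply/eqP; rewrite -subr_eq0; apply/eqP/sX; rewrite -linearB.
apply/eqP; rewrite eq_le normr_ge0 andbT (le_trans (bmap_norm_le f _))//.
by rewrite sep_repr_pi mulr0.
Qed.

Lemma sep_lift_linear X (f : bmap W X) : is_normed X -> linear (sep_lift_fun f).
Proof.
move=> sX a; elim/sep_quotW=> x; elim/sep_quotW=> y.
by rewrite -linearP !sep_lift_funE// linearP.
Qed.

Lemma sep_lift_le X (f : bmap W X) p : `|sep_lift_fun f p| <= `|f| * `|p|.
Proof. exact: bmap_norm_le. Qed.

Definition sep_lift X (sX : is_normed X) (f : bmap W X) : bmap sep_quot X :=
  mk_bmap (sep_lift_linear f sX) (sep_lift_le f).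

Lemma sep_liftE X (sX : is_normed X) (f : bmap W X) x :
  sep_lift sX f (sep_pi x) = f x.
Proof. exact: sep_lift_funE. Qed.

Lemma sep_lift_norm X (sX : is_normed X) (f : bmap W X) : `|sep_lift sX f| <= `|f|.
Proof. exact/bmap_norm_leP/sep_lift_le. Qed.

End SeparatedQuotient.

Section CompletionSpace.
Variables (R : realType) (k : scalar_kind).
Implicit Types V W : semiNormedModType R k.

(* Cauchy sequences, with norm lim |u_n|, modulo those converging to 0. *)
Definition completion V : semiNormedModType R k := sep_quot (cauchy_seq V).

Definition mk_cauchy V (u : nat -> V) (cu : cauchy_sequence u) : cauchy_seq V :=
  CauchySeq (asboolT cu : u \in @cauchy_pred R k V).

Lemma cauchy_seq_eq V (u v : cauchy_seq V) : u =1 v -> u = v.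
Proof. by move=> uv; apply: val_inj; apply: funext. Qed.

Fact cauchy_cst V (x : V) : cauchy_sequence (fun=> x).
Proof. by move=> e e0; exists 0%N => *; rewrite subrr normr0. Qed.

Definition cst_seq V (x : V) : cauchy_seq V := mk_cauchy (cauchy_cst x).

Lemma cst_seq_norm V (x : V) : `|cst_seq x| = `|x|.
Proof.
have h : (fun n => `|cst_seq x n|) @ \oo --> `|x|.
  by apply: (cvg_near_cst `|x|); apply: nearW.
exact: cauchy_norm_eq h.
Qed.

Definition rho_fun V (x : V) : completion V := sep_pi (cst_seq x).

Fact rho_linear V : linear (@rho_fun V).
Proof. by move=> a x y; rewrite /rho_fun -sep_piZ -sep_piD; congr sep_pi; apply: cauchy_seq_eq. Qed.

Lemma rho_fun_norm V (x : V) : `|rho_fun x| = `|x|.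
Proof. by rewrite sep_pi_norm cst_seq_norm. Qed.

Fact rho_le V (x : V) : `|rho_fun x| <= 1 * `|x|.
Proof. by rewrite rho_fun_norm mul1r. Qed.

Definition rho V : bmap V (completion V) := mk_bmap (@rho_linear V) (@rho_le V).

Lemma rho_norm V : `|rho V| <= 1.
Proof. exact/bmap_norm_leP/rho_le. Qed.

Lemma rho_cvg V (u : cauchy_seq V) :
  converges_to (fun n => rho V (u n)) (sep_pi u : completion V).
Proof.
move=> e e0; have e2 : 0 < e / 2 by rewrite divr_gt0.
have [N uN] := cauchy_seqP u e2; exists N => n Nn.
have -> : rho V (u n) - sep_pi u = sep_pi (cst_seq (u n) - u).
  by rewrite sep_piD -[in RHS]scaleN1r sep_piZ scaleN1r.
rewrite sep_pi_norm.
apply: (@le_lt_trans _ _ (e / 2)); last by rewrite ltr_pdivrMr// ltr_pMr// ltr1n.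
by apply: (@cauchy_norm_le _ _ _ _ _ N) => m Nm; apply/ltW/uN.
Qed.

Lemma rho_dense V (p : completion V) (e : R) :
  0 < e -> exists x : V, `|p - rho V x| < e.
Proof.
move=> e0; elim/sep_quotW: p => u; have [N uN] := rho_cvg u e0.
by exists (u N); rewrite distrC uN.
Qed.

Lemma completion_complete V : cauchy_complete (completion V).
Proof.
move=> x cx.
have H n : exists y : V, `|x n - rho V y| < n.+1%:R^-1.
  by apply: rho_dense; rewrite invr_gt0.
have [v vx] := boolp.choice H.
have small (e : R) : 0 < e -> exists N, forall n, (N <= n)%N ->
    `|x n - rho V (v n)| < e.
  move=> e0; exists (Num.truncn e^-1) => n Nn; apply: lt_trans (vx n) _.
  rewrite invf_plt ?posrE// (lt_le_trans (Num.Theory.truncnS_gt _))//.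
  by rewrite ler_nat ltnS.
have cv : cauchy_sequence v.
  move=> e e0; have e3 : 0 < e / 3 by rewrite divr_gt0.
  have [N xN] := cx _ e3; have [M xM] := small _ e3.
  exists (maxn N M) => m n; rewrite !geq_max => /andP[m1 m2] /andP[n1 n2].
  rewrite -rho_fun_norm -[rho_fun _]/(rho V _) linearB.
  have -> : rho V (v m) - rho V (v n) =
      (rho V (v m) - x m) + (x m - x n) + (x n - rho V (v n)).
    by rewrite subrKA subrKA.
  rewrite (le_lt_trans (ler_normD _ _))//.
  have -> : e = e / 3 + e / 3 + e / 3.
    by rewrite -!mulrDl -mulr2n -mulrSr -[X in X / _]mulr_natr mulfK ?pnatr_eq0.
  apply: ltrD; last exact: xM.
  apply: (le_lt_trans (ler_normD _ _)); apply: ltrD; last exact: xN.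
  by rewrite distrC; exact: xM.
exists (sep_pi (mk_cauchy cv)) => e e0.
have e2 : 0 < e / 2 by rewrite divr_gt0.
have [N xN] := small _ e2; have [M vM] := rho_cvg (mk_cauchy cv) e2.
exists (maxn N M) => n; rewrite geq_max => /andP[n1 n2].
rewrite -(subrKA (rho V (v n))) (le_lt_trans (ler_normD _ _))//.
rewrite [ltRHS]splitr; apply: ltrD; [exact: xN|exact: vM].
Qed.

Lemma completion_normed V : is_normed (completion V).
Proof. exact: sep_quot_normed. Qed.

Lemma completion_banach V : is_banach (completion V).
Proof. by split; [exact: completion_normed|exact: completion_complete]. Qed.

Section Map.
Variables (V W : semiNormedModType R k) (f : bmap V W).

Fact cauchy_map_cauchy (u : cauchy_seq V) : cauchy_sequence (f \o u).
Proof.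
move=> e e0; have C0 : 0 < `|f| + 1 by rewrite ltr_wpDl.
have e1 : 0 < e / (`|f| + 1) by rewrite divr_gt0.
have [N uN] := cauchy_seqP u e1; exists N => m n Nm Nn /=.
rewrite -linearB (le_lt_trans (bmap_norm_le _ _))//.
have := uN _ _ Nm Nn; rewrite ltr_pdivlMr// => /(le_lt_trans _)-> //.
by rewrite mulrC ler_wpM2l// lerDl.
Qed.

Definition cauchy_map (u : cauchy_seq V) : cauchy_seq W :=
  mk_cauchy (cauchy_map_cauchy u).

Fact cauchy_map_linear : linear cauchy_map.
Proof. by move=> a u v; apply: cauchy_seq_eq => n /=; rewrite linearP. Qed.

Fact cauchy_map_le u : `|cauchy_map u| <= `|f| * `|u|.
Proof.
have h : (fun n => `|f| * `|u n|) @ \oo --> `|f| * `|u|.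
  by apply: cvgMl_tmp; apply: cauchy_norm_cvg.
apply: (ler_cvg_to (@cauchy_norm_cvg _ _ _ (cauchy_map u)) h).
by apply: nearW => n; apply: bmap_norm_le.
Qed.

Definition completion_map_fun (u : cauchy_seq V) : completion W :=
  sep_pi (cauchy_map u).

Fact completion_map_linear : linear completion_map_fun.
Proof. by move=> a u v; rewrite /completion_map_fun cauchy_map_linear sep_piD sep_piZ. Qed.

Fact completion_map_le u : `|completion_map_fun u| <= `|f| * `|u|.
Proof. by rewrite sep_pi_norm cauchy_map_le. Qed.

Definition completion_map : bmap (completion V) (completion W) :=
  sep_lift (@completion_normed W)
    (mk_bmap completion_map_linear completion_map_le).

Lemma completion_mapE u : completion_map (sep_pi u) = sep_pi (cauchy_map u).
Proof. exact: sep_liftE. Qed.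

Lemma completion_map_norm : `|completion_map| <= `|f|.
Proof.
apply: le_trans (sep_lift_norm _ _) _.
exact/bmap_norm_leP/completion_map_le.
Qed.
End Map.

Lemma converges_unique V (u : nat -> V) (l m : V) :
  is_normed V -> converges_to u l -> converges_to u m -> l = m.
Proof.
move=> sV ul um; apply/eqP; rewrite -subr_eq0; apply/eqP/sV/eqP.
rewrite eq_le normr_ge0 andbT; apply/ler_addgt0Pr => e e0; rewrite add0r.
have e2 : 0 < e / 2 by rewrite divr_gt0.
have [N uN] := ul _ e2; have [M uM] := um _ e2.
rewrite -(subrKA (u (maxn N M))) (le_trans (ler_normD _ _))//.
by rewrite [leRHS]splitr lerD ?ltW// ?uM ?leq_maxr// distrC uN ?leq_maxl.
Qed.

Section Limit.
Variables (B : semiNormedModType R k) (hB : is_banach B).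

Definition cauchy_lim (u : cauchy_seq B) : B :=
  projT1 (cid (hB.2 _ (cauchy_seqP u))).

Lemma cauchy_lim_cvg (u : cauchy_seq B) : converges_to u (cauchy_lim u).
Proof. by rewrite /cauchy_lim; case: cid. Qed.

Lemma cauchy_lim_eq (u : cauchy_seq B) l : converges_to u l -> cauchy_lim u = l.
Proof. exact: (converges_unique hB.1 (cauchy_lim_cvg u)). Qed.

Fact cauchy_lim_norm u : `|cauchy_lim u| = `|u|.
Proof.
apply/esym/cauchy_norm_eq/cvgrPdist_lt => e /(cauchy_lim_cvg u)[N uN].
exists N => // n /= Nn; rewrite (le_lt_trans (ler_dist_seminorm _ _))//.
by rewrite distrC uN.
Qed.

Fact cauchy_lim_linear : linear cauchy_lim.
Proof.
move=> a u v; apply: cauchy_lim_eq => e e0.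
have C0 : 0 < modulus a + 1 by rewrite ltr_wpDl ?modulus_ge0.
have e2 : 0 < e / 2 by rewrite divr_gt0.
have e1 : 0 < e / 2 / (modulus a + 1) by rewrite divr_gt0.
have [N uN] := cauchy_lim_cvg u e1; have [M vM] := cauchy_lim_cvg v e2.
exists (maxn N M) => n; rewrite geq_max => /andP[n1 n2].
have -> : (a *: u + v) n - (a *: cauchy_lim u + cauchy_lim v) =
    a *: (u n - cauchy_lim u) + (v n - cauchy_lim v).
  rewrite [X in X - _ = _]/(a *: u n + v n).
  by rewrite scalerBr opprD addrACA.
rewrite (le_lt_trans (ler_normD _ _))// [ltRHS]splitr ler_ltD ?vM//.
rewrite seminormZ; have := uN _ n1; rewrite ltr_pdivlMr// => /ltW/(le_trans _)-> //.
by rewrite mulrC ler_wpM2l// lerDl.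
Qed.

Fact cauchy_lim_le u : `|cauchy_lim u| <= 1 * `|u|.
Proof. by rewrite cauchy_lim_norm mul1r. Qed.

Definition completion_lim : bmap (completion B) B :=
  sep_lift hB.1 (mk_bmap cauchy_lim_linear cauchy_lim_le).

Lemma completion_limE u : completion_lim (sep_pi u) = cauchy_lim u.
Proof. exact: sep_liftE. Qed.

Lemma completion_lim_norm : `|completion_lim| <= 1.
Proof.
apply: le_trans (sep_lift_norm _ _) _.
exact/bmap_norm_leP/cauchy_lim_le.
Qed.
End Limit.

End CompletionSpace.

Section CompletionMonad.
Variables (R : realType) (k : scalar_kind) (s : norm_kind).
Local Notation selfcat := (selfcat R k s).

Definition banach_subcat : vcat R k s :=
  fullsub (fun V : selfcat => is_banach (V : nspace R k s)).

Definition banach_incl : vfunctor banach_subcat selfcat := fincl _.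

Definition completion_ob (V : nspace R k s) : banach_subcat :=
  exist (fun W : selfcat => is_banach (W : nspace R k s))
    (NSpace (fun=> @completion_normed R k V)) (completion_banach V).

Definition completion_functor : vfunctor selfcat banach_subcat.
refine (@VFunctor R k s selfcat banach_subcat completion_ob
  (fun V W f => completion_map f) _ _ _ _).
- move=> V W a f g; apply: bmap_eq; elim/sep_quotW=> u.
  transitivity (a *: completion_map f (sep_pi u) + completion_map g (sep_pi u));
    last by [].
  rewrite !completion_mapE -sep_piZ -sep_piD; congr sep_pi.
  exact: cauchy_seq_eq.
- by move=> V W f; apply: completion_map_norm.
- move=> V; apply: bmap_eq; elim/sep_quotW=> u.
  by rewrite completion_mapE; congr sep_pi; apply: cauchy_seq_eq.
- move=> V W X g f; apply: bmap_eq; elim/sep_quotW=> u.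
  transitivity (completion_map g (completion_map f (sep_pi u))); last by [].
  by rewrite !completion_mapE; congr sep_pi; apply: cauchy_seq_eq.
Defined.

Definition completion_unit :
  vnat (fid selfcat) (fcomp banach_incl completion_functor).
refine (@VNat R k s selfcat selfcat (fid selfcat)
  (fcomp banach_incl completion_functor)
  (fun V => @VMor R k s selfcat V (sval (completion_ob V)) (rho V)
     (rho_norm V)) _).
move=> V W f; apply: bmap_eq => x.
transitivity (completion_map f (sep_pi (cst_seq x))); last by [].
rewrite completion_mapE.
by congr sep_pi; apply: cauchy_seq_eq.
Defined.

Definition completion_counit :
  vnat (fcomp completion_functor banach_incl) (fid banach_subcat).
refine (@VNat R k s banach_subcat banach_subcat
  (fcomp completion_functor banach_incl) (fid banach_subcat)
  (fun B => @VMor R k s banach_subcat (completion_ob (sval B)) B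
     (completion_lim (proj2_sig B)) (completion_lim_norm (proj2_sig B))) _).
move=> A B f; apply: bmap_eq; elim/sep_quotW=> u.
transitivity (completion_lim (proj2_sig B) (completion_map f (sep_pi u)));
  first by [].
transitivity (f (completion_lim (proj2_sig A) (sep_pi u))); last by [].
rewrite completion_mapE !completion_limE; apply: cauchy_lim_eq => e e0.
have C0 : 0 < `|f| + 1 by rewrite ltr_wpDl.
have e1 : 0 < e / (`|f| + 1) by rewrite divr_gt0.
have [N uN] := cauchy_lim_cvg (proj2_sig A) u e1; exists N => n Nn.
have -> : cauchy_map f u n - f (cauchy_lim (proj2_sig A) u) =
    f (u n - cauchy_lim (proj2_sig A) u) by rewrite linearB.
rewrite (le_lt_trans (bmap_norm_le _ _))//.
have := uN _ Nn; rewrite ltr_pdivlMr// => /(le_lt_trans _)-> //.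
by rewrite mulrC ler_wpM2l// lerDl.
Defined.

Definition completion_adjunction : vadjunction completion_functor banach_incl.
refine (@VAdjunction R k s _ _ _ _ completion_unit completion_counit _ _).
- move=> V; apply: bmap_eq; elim/sep_quotW=> u.
  transitivity (completion_lim (completion_banach V)
    (completion_map (rho V) (sep_pi u))); first by [].
  rewrite completion_mapE completion_limE.
  exact/cauchy_lim_eq/rho_cvg.
- move=> B; apply: bmap_eq => x.
  transitivity (completion_lim (proj2_sig B) (sep_pi (cst_seq x))); first by [].
  rewrite completion_limE; transitivity x; last by [].
  by apply: cauchy_lim_eq => e e0; exists 0%N => n _; rewrite subrr normr0.
Defined.

Definition completion_monad : vmonad selfcat := induced_monad completion_adjunction.

End CompletionMonad.

(* No injectivity: a seminorm may vanish on nonzero vectors. *)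
Definition isometric R k (V W : semiNormedModType R k) (f : bmap V W) : Prop :=
  forall v, `|f v| = `|v|.

Definition dense_image R k (V W : semiNormedModType R k) (f : bmap V W) : Prop :=
  forall (w : W) (e : R), 0 < e -> exists v, `|w - f v| < e.

Definition mor_map R k s (V W : selfcat R k s) (f : vmor V W) :
    bmap (V : nspace R k s) (W : nspace R k s) :=
  vmor_hom f.

(* Main.v *)
From HB Require Import structures.
From mathcomp Require Import all_boot all_order all_algebra.
From mathcomp Require Import complex.
From mathcomp Require Import boolp classical_sets reals topology normedtype.
Require Import Defs.
Import numFieldNormedType.Exports.

Set Implicit Arguments.
Unset Strict Implicit.
Unset Printing Implicit Defensive.

Import Order.TTheory GRing.Theory Num.Theory.
Local Open Scope classical_set_scope.
Local Open Scope ring_scope.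

(**
Both monads invert exactly the dense isometric maps, so the completion monad,
being idempotent, is the idempotent core of the double-dualization monad.

Completion. If f is dense and isometric, so is its completion, which is then
injective; it is also onto, since a point of the completion of W is a limit of
vectors f v_n and the v_n form a Cauchy sequence because f is isometric. As an
isometric bijection it has a nonexpansive inverse (completion_map_inverse).
Conversely, an invertible nonexpansive map with nonexpansive inverse is
isometric, and isometry and density descend from the completion to f because
the units rho are dense and isometric (dense_isometric_of_completion_map).

Double dual. If f : V -> W is dense and isometric, every bounded functional on V
extends uniquely and without increase of norm to W: the scalars are complete, so
the functional factors through the completion of V, which is that of W.
Hence f^* is invertible (precomp_inverse), and a fortiori f^** is.
Conversely, suppose that f^** is invertible, hence isometric. Evaluation
V -> V^** is isometric by the Hahn-Banach theorem (eval_isometric) and natural,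
so f is isometric. Moreover f^* is injective, since the evaluation at any w in W
is of the form f^** L, which depends on a functional only through its
restriction along f. By Hahn-Banach, applied this time to the seminorm given by
the distance to the image of f, injectivity of f^* forces this distance to
vanish, so f is dense (dense_of_precomp_inj).

The Hahn-Banach theorem is obtained here from minimal sublinear functionals,
without extending functionals from subspaces (Hahn_Banach_real), and is carried
over to complex scalars by the usual recovery of a complex linear functional
from its real part (linear_of_re).
*)

(** * Sublinear functionals and the real Hahn-Banach theorem *)

Section SublinearFunctionals.
Variables (R : realType) (E : lmodType R).
Implicit Types (p q : E -> R) (w x y : E).

(** Only one inequality of positive homogeneity is demanded, which is the easier
    one to check; the other follows by rescaling with the inverse
    (sublinearZ). *)
Definition sublinear p : Prop :=
  (forall x y, p (x + y) <= p x + p y) /\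
  (forall (t : R) x, 0 <= t -> p (t *: x) <= t * p x).

Lemma sublinear0 p : sublinear p -> p 0 = 0.
Proof.
move=> [pD pZ]; apply/eqP; rewrite eq_le; apply/andP; split.
  by have := pZ 0 0 (lexx 0); rewrite scale0r mul0r.
by have := pD 0 0; rewrite addr0 lerDl.
Qed.

Lemma sublinear_geN p x : sublinear p -> - p (- x) <= p x.
Proof.
by move=> sp; rewrite lerNl -subr_ge0 opprK -(sublinear0 sp) -(addNr x) sp.1.
Qed.

Lemma sublinearZ p (t : R) x : sublinear p -> 0 <= t -> p (t *: x) = t * p x.
Proof.
move=> sp t_ge0; move: (t_ge0); rewrite le_eqVlt => /predU1P[<-|t0].
  by rewrite scale0r mul0r sublinear0.
apply/eqP; rewrite eq_le sp.2//= -ler_pdivlMl//.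
rewrite -{1}[x]scale1r -(mulVf (lt0r_neq0 t0)) -scalerA.
by rewrite sp.2// invr_ge0.
Qed.

Definition tilt_values p w x : set R :=
  [set p (x + t *: w) - t * p w | t in [set t | 0 <= t]].

(** The largest sublinear functional below p whose value at - w is at most
    - p w: the functional p with its slope in the direction w made constant. *)
Definition tilt p w x : R := inf (tilt_values p w x).

(** By subadditivity t * p w = p (t *: w) <= p (x + t *: w) + p (- x), so the
    values are bounded below by - p (- x). *)
Lemma tilt_values_has_inf p w x : sublinear p -> has_inf (tilt_values p w x).
Proof.
move=> sp; split; first by exists (p (x + 0 *: w) - 0 * p w), 0 => //=.
exists (- p (- x)) => _ [t /= t0 <-].
rewrite lerBrDr addrC lerBlDr -(sublinearZ _ sp t0).
by rewrite -[X in p X](addrK x) addrC [t *: w + x]addrC addrC sp.1.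
Qed.

Lemma tilt_le p w x (t : R) :
  sublinear p -> 0 <= t -> tilt p w x <= p (x + t *: w) - t * p w.
Proof.
move=> sp t0; apply: ge_inf; first by case: (tilt_values_has_inf w x sp).
by exists t.
Qed.

Lemma le_tilt p w x (c : R) :
  (forall t, 0 <= t -> c <= p (x + t *: w) - t * p w) -> c <= tilt p w x.
Proof.
move=> h; apply: lb_le_inf; last by move=> _ [t /= t0 <-]; exact: h.
by exists (p (x + 0 *: w) - 0 * p w), 0 => //=.
Qed.

(** The values of the tilt at x + y and at t *: x are compared with those at x
    and y by adding, respectively rescaling, the parameters of the infimum. *)
Lemma tilt_sublinear p w : sublinear p -> sublinear (tilt p w).
Proof.
move=> sp; split=> [x y|t x t0].
  rewrite -lerBlDr; apply: le_tilt => s s0.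
  rewrite lerBlDr -lerBlDl; apply: le_tilt => t t0.
  rewrite lerBlDl (le_trans (tilt_le _ _ sp (addr_ge0 s0 t0)))//.
  by rewrite scalerDl mulrDl opprD addrACA [leRHS]addrACA lerD2r sp.1.
have h s : 0 <= s -> tilt p w (t *: x) <= t * (p (x + s *: w) - s * p w).
  move=> s0; rewrite (le_trans (tilt_le _ _ sp (mulr_ge0 t0 s0)))//.
  by rewrite -scalerA -scalerDr mulrBr mulrA lerD2r sp.2.
move: t0; rewrite le_eqVlt => /predU1P[t0|t0].
  by have := h 0 (lexx 0); rewrite -t0 !mul0r.
by rewrite -ler_pdivrMl//; apply: le_tilt => s s0; rewrite ler_pdivrMl// h.
Qed.

Lemma tilt_le_id p w x : sublinear p -> tilt p w x <= p x.
Proof.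
move=> sp; have := tilt_le w x sp (lexx 0).
by rewrite scale0r addr0 mul0r subr0.
Qed.

(** The parameter t = 1 in the infimum gives p 0 - p w. *)
Lemma tiltN p w : sublinear p -> tilt p w (- w) <= - p w.
Proof.
move=> sp; have := tilt_le w (- w) sp ler01.
by rewrite scale1r addNr mul1r sublinear0// sub0r.
Qed.

(** The pointwise infimum is bounded below by - p (- x), hence is finite.
    Subadditivity of the infimum is where the chain condition enters: of two
    members of the chain, the smaller one controls both summands. *)
Lemma sublinear_chain_lb p (A : set (E -> R)) :
  sublinear p -> A `<=` [set q | sublinear q /\ forall x, q x <= p x] ->
  (forall q1 q2, A q1 -> A q2 ->
    (forall x, q1 x <= q2 x) \/ (forall x, q2 x <= q1 x)) ->
  exists q, (sublinear q /\ forall x, q x <= p x) /\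
    forall q', A q' -> forall x, q x <= q' x.
Proof.
move=> sp Ap Atot.
have [A0|/set0P[q0 Aq0]] := eqVneq A set0.
  by exists p; split=> // q; rewrite A0.
pose q x := inf [set q' x | q' in A].
have qle q' x : A q' -> q x <= q' x.
  move=> Aq'; apply: ge_inf; last by exists q'.
  exists (- p (- x)) => _ [r Ar <-]; have [sr rp] := Ap _ Ar.
  by rewrite (le_trans _ (sublinear_geN x sr))// lerN2.
have leq c x : (forall q', A q' -> c <= q' x) -> c <= q x.
  by move=> h; apply: lb_le_inf => [|_ [r /h ? <-]//]; exists (q0 x), q0.
exists q; split; last by move=> q' Aq' x; exact: qle.
split; last by move=> x; apply: le_trans (qle _ _ Aq0) _; case: (Ap _ Aq0).
split=> [x y|t x t0].
  rewrite -lerBlDr; apply: (leq) => q1 A1; rewrite lerBlDr -lerBlDl.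
  apply: (leq) => q2 A2; rewrite lerBlDl.
  have [[q1D _] _] := Ap _ A1; have [[q2D _] _] := Ap _ A2.
  case: (Atot _ _ A1 A2) => h.
    by rewrite (le_trans (qle _ _ A1))// (le_trans (q1D _ _))// lerD2l.
  by rewrite (le_trans (qle _ _ A2))// (le_trans (q2D _ _))// lerD2r.
have h q' : A q' -> q (t *: x) <= t * q' x.
  by move=> A'; rewrite (le_trans (qle _ _ A'))//; have [[_ ->]] := Ap _ A'.
move: t0; rewrite le_eqVlt => /predU1P[t0|t0].
  by have := h _ Aq0; rewrite -t0 !mul0r.
by rewrite -ler_pdivrMl//; apply: (leq) => q' A'; rewrite ler_pdivrMl// h.
Qed.

(** Zorn's lemma for the reverse pointwise order. *)
Lemma minimal_sublinear p : sublinear p ->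
  exists q, [/\ sublinear q, forall x, q x <= p x &
    forall r, sublinear r -> (forall x, r x <= q x) -> forall x, q x <= r x].
Proof.
move=> sp; pose T := {q | sublinear q /\ forall x, q x <= p x}.
pose below (q r : T) := `[< forall x, sval r x <= sval q x >].
have [||||[q [sq qp]] qmin] := @ZL_preorder T _ below.
- by exists p.
- by move=> q; apply/asboolP.
- move=> q r u /asboolP qr /asboolP ru; apply/asboolP => x.
  exact: le_trans (ru x) (qr x).
- move=> A Atot.
  have [|q1 q2|q [hq qle]] := @sublinear_chain_lb p [set sval r | r in A] sp.
  + by move=> _ [[r hr] _ <-].
  + move=> [r1 A1 <-] [r2 A2 <-].
    by case: (Atot _ _ A1 A2) => /asboolP; [right|left].
  by exists (exist _ q hq) => r Ar; apply/asboolP/qle; exists r.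
exists q; split=> // r sr rq x.
have hr : sublinear r /\ forall x, r x <= p x.
  by split=> // y; apply: le_trans (rq y) (qp y).
have /asboolP := qmin (exist _ r hr) (asboolT rq); exact.
Qed.

(** Tilting q in the direction x gives a sublinear functional below q, so by
    minimality q itself satisfies q (- x) <= - q x; thus q is odd, and an odd
    sublinear functional is linear. *)
Lemma minimal_sublinear_linear q : sublinear q ->
  (forall r, sublinear r -> (forall x, r x <= q x) -> forall x, q x <= r x) ->
  (forall x y, q (x + y) = q x + q y) /\
  (forall (t : R) x, q (t *: x) = t * q x).
Proof.
move=> sq qmin.
have qN x : q (- x) = - q x.
  apply/eqP; rewrite eq_le; apply/andP; split.
    apply: le_trans (tiltN x sq); apply: qmin; first exact: tilt_sublinear.
    by move=> y; apply: tilt_le_id.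
  by have := sublinear_geN (- x) sq; rewrite opprK.
split=> [x y|t x].
  apply/eqP; rewrite eq_le sq.1 /=.
  by rewrite -lerN2 opprD -!qN opprD sq.1.
have [t0|/ltW t0] := leP 0 t; first by rewrite sublinearZ.
by rewrite -[t]opprK scaleNr qN sublinearZ ?oppr_ge0 -?mulNr.
Qed.

(** A minimal u below the tilt of p in the direction w is linear, and the bound
    u (- w) <= - p w reads p w <= u w. *)
Theorem Hahn_Banach_real p w : sublinear p ->
  exists u : E -> R, [/\ forall x y, u (x + y) = u x + u y,
    forall (t : R) x, u (t *: x) = t * u x, forall x, u x <= p x & u w = p w].
Proof.
move=> sp; have [u [su up umin]] := minimal_sublinear (tilt_sublinear w sp).
have [uD uZ] := minimal_sublinear_linear su umin.
have ulep x : u x <= p x by rewrite (le_trans (up x))// tilt_le_id.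
exists u; split=> //; apply/eqP; rewrite eq_le ulep /=.
rewrite -lerN2 -(mulN1r (u w)) -uZ scaleN1r.
exact: le_trans (up _) (tiltN w sp).
Qed.

End SublinearFunctionals.

(** * Hahn-Banach theorem for seminorms over real or complex scalars *)

Section ScalarParts.
Variables (R : realType) (k : scalar_kind).

Definition re_scalar : scalars R k -> R :=
  match k as k' return
    (match k' with RealScalars => R | ComplexScalars => R[i] end : fieldType) -> R
  with
  | RealScalars => id
  | ComplexScalars => fun z : R[i] => complex.Re z
  end.

End ScalarParts.

Section ScalarPartsTheory.
Variables (R : realType) (k : scalar_kind).

Lemma real_scalarD (s t : R) :
  real_scalar k (s + t) = real_scalar k s + real_scalar k t.
Proof. by case: k => //=; rewrite rmorphD. Qed.

Lemma real_scalarM (s t : R) :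
  real_scalar k (s * t) = real_scalar k s * real_scalar k t.
Proof. by case: k => //=; rewrite rmorphM. Qed.

Lemma le_re_modulus (a : scalars R k) : re_scalar a <= modulus a.
Proof.
case: k a => [a|[a b]] /=; first exact: ler_norm.
by rewrite (le_trans (ler_norm _))// -sqrtr_sqr ler_wsqrtr// lerDl sqr_ge0.
Qed.

(** The complex conjugate of a is a witness in the complex case, a itself in the
    real one. *)
Lemma conj_witness (a : scalars R k) :
  exists c : scalars R k, modulus c = modulus a /\
    re_scalar (c * a) = modulus a ^+ 2.
Proof.
case: k a => [a|[a b]].
  by exists a; split=> //=; rewrite -expr2 real_normK ?num_real.
exists (Complex a (- b)); split; first by rewrite /= sqrrN.
by rewrite /= sqr_sqrtr ?addr_ge0 ?sqr_ge0// mulNr opprK -!expr2.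
Qed.

End ScalarPartsTheory.

Section RestrictionOfScalars.
Variables (R : realType) (k : scalar_kind) (V : lmodType (scalars R k)).

(** A name for V different from V, carrying the module structure over the reals;
    over complex scalars this differs from the given structure. *)
Definition realification : Type := V.
HB.instance Definition _ := GRing.Zmodule.on realification.

Definition real_scale (t : R) (x : realification) : realification :=
  real_scalar k t *: (x : V).

Fact real_scaleA s t x : real_scale s (real_scale t x) = real_scale (s * t) x.
Proof. by rewrite /real_scale scalerA real_scalarM. Qed.
Fact real_scale1 : left_id 1 real_scale.
Proof. by move=> x; rewrite /real_scale real_scalar1 scale1r. Qed.
Fact real_scaleDr : right_distributive real_scale +%R.
Proof. by move=> t x y; apply: scalerDr. Qed.
Fact real_scaleDl x : {morph real_scale^~ x : s t / s + t}.
Proof. by move=> s t; rewrite /real_scale real_scalarD scalerDl. Qed.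

HB.instance Definition _ :=
  GRing.Zmodule_isLmodule.Build R realification
    real_scaleA real_scale1 real_scaleDr real_scaleDl.

End RestrictionOfScalars.

(** Over complex scalars, phi x = u x - i u (i x). *)
Lemma linear_of_re (R : realType) (k : scalar_kind) (V : lmodType (scalars R k))
    (u : V -> R) :
  (forall x y, u (x + y) = u x + u y) ->
  (forall (t : R) x, u (real_scalar k t *: x) = t * u x) ->
  exists2 phi : V -> scalar_space R k,
    linear phi & forall x, re_scalar (phi x) = u x.
Proof.
case: k V u => V u uD uZ.
  by exists u => // a x y; rewrite uD; congr (_ + _); apply: uZ.
exists (fun x =>
  Complex (u x) (- u (('i%C : scalars R ComplexScalars) *: x))) => //.
move=> a x y.
have uN z : u (- z) = - u z.
  rewrite -[RHS]mulN1r -uZ -[- z]scaleN1r; congr (u (_ *: _)).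
  by rewrite /= rmorphN.
pose I : scalars R ComplexScalars := 'i%C.
have uC z : u (a *: z) = complex.Re a * u z + complex.Im a * u (I *: z).
  rewrite -!uZ -uD scalerA -scalerDl; congr (u (_ *: _)).
  by case: (a) => b c; simpc.
apply/eqP; rewrite eq_complex /=; apply/andP; split.
  by rewrite uD uC; case: (a) => b c /=; rewrite mulrN opprK.
rewrite scalerDr uD opprD scalerA mulrC -scalerA uC scalerA.
have -> : I * I = - 1 by rewrite /I; simpc.
rewrite scaleN1r uN; case: (a) => b c /=.
by rewrite opprD !mulrN opprK; apply/eqP.
Qed.

(** A linear phi whose real part is dominated by the seminorm p is itself
    dominated by p in modulus: with c the conjugate of phi x, the square of the
    modulus of phi x is the real part of phi (c *: x), hence at most
    p (c *: x) <= modulus c * p x. *)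
Theorem Hahn_Banach (R : realType) (k : scalar_kind) (V : lmodType (scalars R k))
    (p : V -> R) (w : V) :
  (forall x y, p (x + y) <= p x + p y) ->
  (forall (a : scalars R k) x, p (a *: x) <= modulus a * p x) ->
  exists phi : V -> scalar_space R k,
    [/\ linear phi, forall x, `|phi x| <= p x & `|phi w| = p w].
Proof.
move=> pD pZ.
have sp : @sublinear R (realification V) p.
  split=> // t x t0; rewrite (le_trans (pZ _ _))// modulus_real.
  by rewrite ger0_norm.
have p0 x : 0 <= p x.
  have h : p (- x) <= p x.
    by rewrite -scaleN1r (le_trans (pZ _ _))// modulusN modulus1 mul1r.
  have := pD x (- x); rewrite subrr [X in X <= _](sublinear0 sp).
  by move=> /le_trans/(_ (lerD (lexx _) h)); rewrite -mulr2n pmulrn_lge0.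
have [u [uD uZ up uw]] := @Hahn_Banach_real R (realification V) p w sp.
have [phi lphi phiu] := linear_of_re uD uZ.
have phip x : `|phi x| <= p x.
  have [c [mc rec]] := conj_witness (phi x).
  have : modulus (phi x) ^+ 2 <= modulus (phi x) * p x.
    rewrite -rec -[c * phi x](GRing.scalable_linear lphi c x) phiu.
    by rewrite (le_trans (up _))// (le_trans (pZ _ _))// mc.
  rewrite expr2.
  have [m0 _|nz] := eqVneq (modulus (phi x)) 0.
    by rewrite [X in X <= _]m0.
  by rewrite ler_pM2l// lt_def nz modulus_ge0.
exists phi; split=> //; apply/eqP; rewrite eq_le phip /= -uw -phiu.
exact: le_re_modulus.
Qed.

(** * Completeness of the scalars *)

Lemma real_cauchy_cvg (R : realType) (u : nat -> R) :
  (forall e : R, 0 < e -> exists N, forall m n, (N <= m)%N -> (N <= n)%N ->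
     `|u m - u n| < e) ->
  exists l : R, forall e : R, 0 < e -> exists N, forall n, (N <= n)%N ->
    `|u n - l| < e.
Proof.
move=> cu; have /cvg_ex[l ul] : cvg (u @ \oo).
  apply/cauchy_cvgP/cauchy_ballP => e /cu[N uN].
  exists ([set x | exists2 n, (N <= n)%N & u n = x],
          [set x | exists2 n, (N <= n)%N & u n = x]) => /=.
    by split; exists N => // n /= Nn; exists n.
  move=> [x y] /= [[m Nm <-] [n Nn <-]].
  by rewrite /ball /= uN.
exists l => e e0; have /cvgrPdist_lt/(_ _ e0)[N _ h] := ul.
by exists N => n /h; rewrite distrC.
Qed.

Lemma scalars_banach (R : realType) (k : scalar_kind) :
  is_banach (scalar_space R k).
Proof.
split; first exact: scalar_normed.
case: k => u cu; first exact: real_cauchy_cvg.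
have nRe (z : R[i]) : `|complex.Re z| <= Normc.normc z.
  by case: z => a b; rewrite /= -sqrtr_sqr ler_wsqrtr// lerDl sqr_ge0.
have nIm (z : R[i]) : `|complex.Im z| <= Normc.normc z.
  by case: z => a b; rewrite /= -sqrtr_sqr ler_wsqrtr// lerDr sqr_ge0.
have le_n (a b : R) : Normc.normc (a +i* b)%C <= `|a| + `|b|.
  rewrite /= -[leRHS]ger0_norm ?addr_ge0// -sqrtr_sqr ler_wsqrtr//.
  rewrite sqrrD !real_normK ?num_real// addrAC lerDl.
  by rewrite mulrn_wge0// mulr_ge0.
have [e e0|a ua] := @real_cauchy_cvg R (fun n => complex.Re (u n)).
  have [N uN] := cu e e0; exists N => m n Nm Nn.
  apply: le_lt_trans (uN m n Nm Nn); move: (u m) (u n) => [c d] [c' d'].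
  exact: (nRe ((c +i* d) - (c' +i* d'))%C).
have [e e0|b ub] := @real_cauchy_cvg R (fun n => complex.Im (u n)).
  have [N uN] := cu e e0; exists N => m n Nm Nn.
  apply: le_lt_trans (uN m n Nm Nn); move: (u m) (u n) => [c d] [c' d'].
  exact: (nIm ((c +i* d) - (c' +i* d'))%C).
exists (a +i* b)%C => e e0; have e2 : 0 < e / 2 by rewrite divr_gt0.
have [N uN] := ua _ e2; have [M uM] := ub _ e2.
exists (maxn N M) => n; rewrite geq_max => /andP[/uN + /uM].
move: (u n) => [c d] /= ca db.
by rewrite (le_lt_trans (le_n (c - a) (d - b)))// [ltRHS]splitr ltrD.
Qed.

(** * Bounded maps: inverses and uniqueness on dense images *)

Section BoundedMapFacts.
Variables (R : realType) (k : scalar_kind).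
Implicit Types V W X : semiNormedModType R k.

Lemma bmapB V W (f : bmap V W) x y : f (x - y) = f x - f y.
Proof. exact: linearB. Qed.

Lemma bmap_inverse V W (f : bmap V W) : injective f ->
  (forall y, exists2 x, f x = y & `|x| <= `|y|) ->
  exists g : bmap W V, [/\ `|g| <= 1, cancel f g & cancel g f].
Proof.
move=> finj fsurj.
have /boolp.choice[g gP] y : exists x, f x = y /\ `|x| <= `|y|.
  by have [x ? ?] := fsurj y; exists x.
have fK : cancel g f by move=> y; case: (gP y).
have lg : linear g by move=> a x y; apply: finj; rewrite fK linearP /= !fK.
have gle y : `|g y| <= 1 * `|y| by rewrite mul1r; case: (gP y).
exists (mk_bmap lg gle); split=> //; first exact/bmap_norm_leP.
by move=> x; apply: finj; rewrite fK.
Qed.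

(** Neither f nor g increases the norm, and g brings f v back to v. *)
Lemma isometric_of_inverse V W (f : bmap V W) (g : bmap W V) :
  `|f| <= 1 -> `|g| <= 1 -> cancel f g -> isometric f.
Proof.
move=> /bmap_norm_le1P fle /bmap_norm_le1P gle fK v.
by apply/eqP; rewrite eq_le fle -{1}(fK v) gle.
Qed.

Lemma isometric_inj V W (f : bmap V W) :
  is_normed V -> isometric f -> injective f.
Proof.
move=> sV fi x y fxy; apply/eqP; rewrite -subr_eq0; apply/eqP/sV.
by rewrite -fi bmapB fxy subrr normr0.
Qed.

(** g w - h w = (g - h) (w - f v) for every v, and w - f v can be made
    arbitrarily small. *)
Lemma eq_on_dense V W X (f : bmap V W) (g h : bmap W X) :
  dense_image f -> is_normed X -> (forall v, g (f v) = h (f v)) -> g =1 h.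
Proof.
move=> fd sX gh w; apply/eqP; rewrite -subr_eq0; apply/eqP/sX/eqP.
rewrite eq_le normr_ge0 andbT; apply/ler_addgt0Pr => e e0; rewrite add0r.
have C0 : 0 < `|g| + `|h| + 1 by rewrite ltr_wpDl ?addr_ge0.
have [v wv] := fd w _ (divr_gt0 e0 C0).
have -> : g w - h w = g (w - f v) - h (w - f v).
  by rewrite (bmapB g) (bmapB h) gh opprB addrA subrK.
rewrite (le_trans (ler_normB _ _))//.
rewrite (le_trans (lerD (bmap_norm_le _ _) (bmap_norm_le _ _)))// -mulrDl.
move: wv; rewrite ltr_pdivlMr// => /ltW; apply: le_trans.
by rewrite mulrC ler_wpM2l// lerDl.
Qed.

(** * Completions of dense isometric maps *)

Lemma rho_isometric V : isometric (rho V).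
Proof. exact: rho_fun_norm. Qed.

Lemma rho_dense_image V : dense_image (rho V).
Proof. exact: rho_dense. Qed.

Lemma completion_map_rho V W (f : bmap V W) v :
  completion_map f (rho V v) = rho W (f v).
Proof. by rewrite [LHS]completion_mapE; congr sep_pi; exact: cauchy_seq_eq. Qed.

Lemma completion_lim_rho X (hX : is_banach X) x :
  completion_lim hX (rho X x) = x.
Proof.
rewrite [LHS]completion_limE; apply: cauchy_lim_eq => e e0.
by exists 0%N => n _; rewrite subrr normr0.
Qed.

(** Both sides are bounded maps that agree on the dense image of rho. *)
Lemma rho_completion_lim X (hX : is_banach X) p :
  rho X (completion_lim hX p) = p.
Proof.
apply: (@eq_on_dense _ _ _ (rho X) (bcomp (rho X) (completion_lim hX)) (bid _)).
- exact: rho_dense_image.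
- exact: completion_normed.
- by move=> x; congr (rho X _); exact: completion_lim_rho.
Qed.

Lemma completion_map_isometric V W (f : bmap V W) :
  isometric f -> isometric (completion_map f).
Proof.
move=> fi; elim/sep_quotW=> u; rewrite completion_mapE !sep_pi_norm.
apply: cauchy_norm_eq; under eq_fun do rewrite /= fi.
exact: cauchy_norm_cvg.
Qed.

(** A point q is the limit of some rho (f (v n)); since f and rho are isometric,
    v is a Cauchy sequence, and its class is sent to q. *)
Lemma completion_map_surj V W (f : bmap V W) :
  dense_image f -> isometric f ->
  forall q, exists p, completion_map f p = q.
Proof.
move=> fd fi q.
have near n : exists v, `|q - rho W (f v)| < n.+1%:R^-1.
  have e0 : 0 < (n.+1%:R^-1 / 2 : R) by rewrite divr_gt0 ?invr_gt0.
  have [w qw] := rho_dense q e0; have [v wv] := fd w _ e0; exists v.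
  rewrite -(subrKA (rho W w)) (le_lt_trans (ler_normD _ _))// [ltRHS]splitr.
  by rewrite ltrD// -bmapB [X in X < _]rho_isometric.
have [v qv] := boolp.choice near.
have cvq : converges_to (fun n => rho W (f (v n))) q.
  move=> e e0; exists (Num.truncn e^-1) => n Nn; rewrite distrC.
  apply: lt_trans (qv n) _.
  rewrite invf_plt ?posrE// (lt_le_trans (Num.Theory.truncnS_gt _))//.
  by rewrite ler_nat ltnS.
have cv : cauchy_sequence v.
  move=> e e0; have e2 : 0 < e / 2 by rewrite divr_gt0.
  have [N vN] := cvq _ e2; exists N => m n Nm Nn.
  rewrite -fi -rho_isometric !bmapB -(subrKA q).
  apply: (le_lt_trans (ler_normD _ _)); rewrite [ltRHS]splitr.
  by apply: ltrD; [exact: vN|rewrite distrC; exact: vN].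
exists (sep_pi (mk_cauchy cv)); rewrite completion_mapE.
apply: (converges_unique (@completion_normed _ _ W) _ cvq).
exact: (rho_cvg (cauchy_map f (mk_cauchy cv))).
Qed.

Lemma completion_map_inverse V W (f : bmap V W) :
  dense_image f -> isometric f ->
  exists g : bmap (completion W) (completion V),
    [/\ `|g| <= 1, cancel (completion_map f) g & cancel g (completion_map f)].
Proof.
move=> fd fi; have cfi := completion_map_isometric fi.
apply: bmap_inverse; first exact: isometric_inj (@completion_normed _ _ V) cfi.
by move=> q; have [p <-] := completion_map_surj fd fi q; exists p; rewrite ?cfi.
Qed.

(** To approximate w, the point g (rho w) of the completion of V is
    approximated by some rho v; applying the isometric completion of f and
    naturality of rho yields rho (f v) close to rho w. *)
Lemma dense_isometric_of_completion_map V W (f : bmap V W)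
    (g : completion W -> completion V) :
  isometric (completion_map f) -> cancel g (completion_map f) ->
  dense_image f /\ isometric f.
Proof.
move=> cfi gK; split=> [w e e0|v]; last first.
  by rewrite -rho_isometric -completion_map_rho cfi rho_isometric.
have [v pv] := rho_dense (g (rho W w)) e0; exists v.
by rewrite -rho_isometric bmapB -completion_map_rho -[rho W w]gK -bmapB cfi.
Qed.

(** psi is the composite of rho W with the inverse of the completion of f, the
    completion of phi and the limit map of X. *)
Lemma banach_extension V W X (f : bmap V W) (phi : bmap V X) :
  dense_image f -> isometric f -> is_banach X ->
  exists psi : bmap W X, (forall v, psi (f v) = phi v) /\ `|psi| <= `|phi|.
Proof.
move=> fd fi hX; have [g [gle fK _]] := completion_map_inverse fd fi.
exists (bcomp (completion_lim hX) (bcomp (completion_map phi) (bcomp g (rho W)))).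
split=> [v|].
  rewrite -[LHS]/(completion_lim hX (completion_map phi (g (rho W (f v))))).
  by rewrite -completion_map_rho fK completion_map_rho completion_lim_rho.
have limle := (bmap_norm_le1P (completion_lim hX)).1 (completion_lim_norm hX).
apply/bmap_norm_leP => // w; apply: le_trans (limle _) _.
apply: le_trans (bmap_norm_le (completion_map phi) (g (rho W w))) _.
apply: ler_pM => //; first exact: completion_map_norm.
apply: le_trans ((bmap_norm_le1P g).1 gle _) _.
by rewrite [leLHS]rho_isometric.
Qed.

Lemma precomp_inverse V W X (f : bmap V W) :
  dense_image f -> isometric f -> is_banach X ->
  exists g : bmap (bmap V X) (bmap W X),
    [/\ `|g| <= 1, cancel (precomp X f) g & cancel g (precomp X f)].
Proof.
move=> fd fi hX; apply: bmap_inverse => [g h gh|phi].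
  apply/bmap_eq/(eq_on_dense fd hX.1) => v.
  by rewrite -[LHS]/(precomp X f g v) gh.
have [psi [psif psile]] := banach_extension phi fd fi hX.
by exists psi => //; apply: bmap_eq.
Qed.

(** * Duals and the Hahn-Banach theorem *)

Lemma norming_functional V (x : V) :
  exists phi : bmap V (scalar_space R k), `|phi| <= 1 /\ `|phi x| = `|x|.
Proof.
have [||phi [lphi phile phix]] :=
    @Hahn_Banach R k V (fun y => `|y|) x; first exact: ler_normD.
  by move=> a y; rewrite seminormZ.
have phile1 y : `|phi y| <= 1 * `|y| by rewrite mul1r.
by exists (mk_bmap lphi phile1); split=> //; apply/bmap_norm_leP.
Qed.

(** The inequality that is not immediate holds because evaluating x at a norming
    functional already gives the norm of x. *)
Lemma eval_isometric V : isometric (eval V (scalar_space R k)).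
Proof.
move=> x; apply/eqP; rewrite eq_le; apply/andP; split.
  have [h _] := bmap_norm_le1P (eval V (scalar_space R k)).
  exact: h (@eval_norm _ _ _ _) x.
have [phi [phi1 <-]] := norming_functional x.
rewrite -[phi x]/(eval V _ x phi) (le_trans (bmap_norm_le _ _))//.
by rewrite -[leRHS]mulr1 ler_wpM2l.
Qed.

Section DistanceToImage.
Variables (V W : semiNormedModType R k) (f : bmap V W).

Definition image_dist (w : W) : R := inf [set `|w - f v| | v in setT].

Lemma image_dist_le w v : image_dist w <= `|w - f v|.
Proof.
by apply: ge_inf; [exists 0 => _ [x _ <-]|exists v].
Qed.

Lemma le_image_dist w (c : R) : (forall v, c <= `|w - f v|) -> c <= image_dist w.
Proof.
move=> h; apply: lb_le_inf; last by move=> _ [v _ <-].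
by exists `|w - f 0|, 0.
Qed.

Lemma image_distD x y : image_dist (x + y) <= image_dist x + image_dist y.
Proof.
rewrite -lerBlDr; apply: le_image_dist => v.
rewrite lerBlDr -lerBlDl; apply: le_image_dist => v'; rewrite lerBlDl.
rewrite (le_trans (image_dist_le _ (v + v')))//.
by rewrite linearD opprD addrACA ler_normD.
Qed.

Lemma image_distZ (a : scalars R k) x :
  image_dist (a *: x) <= modulus a * image_dist x.
Proof.
have h v : image_dist (a *: x) <= modulus a * `|x - f v|.
  by rewrite (le_trans (image_dist_le _ (a *: v)))// linearZ -scalerBr seminormZ.
have [a0|a0] := eqVneq (modulus a) 0.
  by have := h 0; rewrite a0 !mul0r.
have a_gt0 : 0 < modulus a by rewrite lt_def a0 modulus_ge0.
by rewrite -ler_pdivrMl//; apply: le_image_dist => v; rewrite ler_pdivrMl.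
Qed.

(** Hahn-Banach for the seminorm image_dist gives a bounded functional that
    attains the distance of w to the image and vanishes on the image; its
    restriction along f is 0, so by injectivity the functional is 0 and the
    distance is 0. *)
Lemma dense_of_precomp_inj :
  injective (precomp (scalar_space R k) f) -> dense_image f.
Proof.
move=> finj w e e0.
have [phi [lphi phile phiw]] := Hahn_Banach w image_distD image_distZ.
have phile1 y : `|phi y| <= 1 * `|y|.
  rewrite mul1r (le_trans (phile y))// (le_trans (image_dist_le _ 0))//.
  by rewrite linear0 subr0.
have phi0 : mk_bmap lphi phile1 = 0.
  apply: finj; rewrite linear0; apply: bmap_eq => v; apply: scalar_normed.
  apply/eqP; rewrite eq_le normr_ge0 andbT (le_trans (phile _))//.
  by rewrite (le_trans (image_dist_le _ v))// subrr normr0.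
have w0 : image_dist w = 0.
  by rewrite -phiw -[phi w]/(mk_bmap lphi phile1 w) phi0 normr0.
have [||_ [v _ <-] wv] := @inf_lt _ [set `|w - f v| | v in setT] e.
- by exists `|w - f 0|, 0.
- by rewrite -[inf _]/(image_dist w) w0.
- by exists v.
Qed.
End DistanceToImage.

End BoundedMapFacts.

(** * The morphisms inverted by the two monads *)

Lemma completion_idempotent (R : realType) (k : scalar_kind) (s : norm_kind) :
  idempotent (completion_monad R k s).
Proof.
move=> V; exists (vunit (completion_monad R k s) (completion_monad R k s V)).
split; apply: bmap_eq => p.
  exact: rho_completion_lim.
exact: completion_lim_rho.
Qed.

Lemma completion_invertedP (R : realType) (k : scalar_kind) (s : norm_kind)
    (V W : selfcat R k s) (f : vmor V W) :
  inverted (completion_monad R k s) f <->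
  dense_image (mor_map f) /\ isometric (mor_map f).
Proof.
split=> [[g [gf fg]]|[fd fi]].
  apply: (@dense_isometric_of_completion_map _ _ _ _ (mor_map f) (mor_map g)).
    apply: (@isometric_of_inverse _ _ _ _ _ (mor_map g)).
    - exact: vmor_le1 (fmor (completion_monad R k s) f).
    - exact: vmor_le1 g.
    - by move=> p; have := congr1 (fun h : bmap _ _ => h p) gf.
  by move=> q; have := congr1 (fun h : bmap _ _ => h q) fg.
have [g [gle fK gK]] := completion_map_inverse fd fi.
by exists (@VMor R k s (selfcat R k s) (completion_monad R k s W)
  (completion_monad R k s V) g gle); split; apply: bmap_eq.
Qed.

Lemma double_dual_invertedP (R : realType) (k : scalar_kind) (s : norm_kind)
    (V W : selfcat R k s) (f : vmor V W) :
  inverted (double_dual_monad R k s) f <->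
  dense_image (mor_map f) /\ isometric (mor_map f).
Proof.
pose S := scalar_space R k; pose Tf := precomp S (precomp S (mor_map f)).
split=> [[g [gf fg]]|[fd fi]].
  have Tfi : isometric Tf.
    apply: (@isometric_of_inverse _ _ _ _ _ (mor_map g)).
    - exact: vmor_le1 (fmor (double_dual_monad R k s) f).
    - exact: vmor_le1 g.
    - by move=> L; have := congr1 (fun h : bmap _ _ => h L) gf.
  split; last first.
    (* Naturality of evaluation transfers isometry from f^** to f. *)
    move=> v; rewrite -eval_isometric -[RHS]eval_isometric -[RHS]Tfi.
    by congr (`|_|); apply: bmap_eq.
  (* Every evaluation on W^* is f^** L for some L, hence factors through f^*. *)
  apply: dense_of_precomp_inj => phi psi eq_f; apply: bmap_eq => w.
  have gE (xi : bmap _ S) :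
      eval _ S w xi = mor_map g (eval _ S w) (precomp S (mor_map f) xi).
    have := congr1 (fun h : bmap _ _ => h (eval _ S w)) fg.
    by move/(congr1 (fun h : bmap _ _ => h xi)).
  by rewrite -[LHS]/(eval _ S w phi) -[RHS]/(eval _ S w psi) !gE eq_f.
(* The transpose of an inverse of f^* is an inverse of f^**. *)
have [g [gle fK gK]] := precomp_inverse fd fi (scalars_banach R k).
have gle' : `|precomp S g| <= 1 := le_trans (precomp_norm _ _) gle.
exists (@VMor R k s (selfcat R k s) (double_dual_monad R k s W)
  (double_dual_monad R k s V) (precomp S g) gle').
split; apply: bmap_eq => L; apply: bmap_eq => phi; apply: (congr1 L).
  exact: gK.
exact: fK.
Qed.

Theorem theorem5p5 (R : realType) (k : scalar_kind) (s : norm_kind) :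
  is_idempotent_core (completion_monad R k s) (double_dual_monad R k s) /\
  (forall (V W : selfcat R k s) (f : vmor V W),
     (inverted (double_dual_monad R k s) f <->
      inverted (completion_monad R k s) f) /\
     (inverted (completion_monad R k s) f <->
      dense_image (mor_map f) /\ isometric (mor_map f))).
Proof.
split; first split.
- exact: completion_idempotent.
- by move=> V W f; rewrite completion_invertedP double_dual_invertedP.
- by move=> V W f; rewrite !completion_invertedP double_dual_invertedP.
Qed.
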